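(* For every nonzero cardinal $\kappa\le\mathfrak{c}$, the Hilbert space $\ell_2(\kappa)$ contains a dense divisible Banakh subgroup $L$ such that $d[L^2]=\mathbb{R}_+$.
   Context: $\mathfrak{c}$ is the cardinality of the continuum and $\mathbb{R}_+=[0,\infty)$. $\ell_2(\kappa)$ is the real Hilbert space of all functions $x:\kappa\to\mathbb{R}$ with $\sum_{\alpha\in\kappa}|x(\alpha)|^2<\infty$, with inner product $\langle x|y\rangle=\sum_{\alpha\in\kappa}x(\alpha)y(\alpha)$, norm $\|x\|=\sqrt{\langle x|x\rangle}$ and metric $d(x,y)=\|x-y\|$. A subgroup is a nonempty subset $X$ with $X-X\subseteq X$. A subgroup $L$ is divisible if for every prime $p$ and every $x\in L$ there exists $y\in L$ with $py=x$. For a metric space $(X,d)$, $d[X^2]=\{d(x,y):x,y\in X\}$ and $\mathsf{S}(c;r)=\{x\in X:d(x,c)=r\}$. A metric space $(X,d)$ is a Banakh space if for every $c\in X$ and every $r\in d[X^2]$ there exist points $x,y\in X$ such that $\mathsf{S}(c;r)=\{x,y\}$ and $d(x,y)=2r$. A subgroup of $\ell_2(\kappa)$ is called Banakh if it is a Banakh space with respect to the metric inherited from $\ell_2(\kappa)$. *)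

(* Defs.v *)
From HB Require Import structures.
From mathcomp Require Import all_boot all_order all_algebra.
From mathcomp Require Import ring lra.
From mathcomp Require Import all_classical all_reals all_analysis.

Set Implicit Arguments.
Unset Strict Implicit.
Unset Printing Implicit Defensive.

Import Order.TTheory GRing.Theory Num.Theory.
Import numFieldNormedType.Exports.

Local Open Scope classical_set_scope.
Local Open Scope ring_scope.

Section square_sum.
Variables (R : realType) (K : choiceType).
Implicit Types x y : K -> R.

(* Possibly infinite. *)
Definition sqsum x : \bar R := \esum_(a in [set: K]) (`|x a| ^+ 2)%:E.

Definition square_summable : {pred K -> R} :=
  [pred x | `[< (sqsum x < +oo)%E >]].

Lemma square_summableP x : reflect (sqsum x < +oo)%E (x \in square_summable).
Proof. exact: asboolP. Qed.

Lemma sqsum_ge0 x : (0 <= sqsum x)%E.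
Proof. by apply: esum_ge0 => a _; rewrite lee_fin sqr_ge0. Qed.

Lemma sqsum_fin_num x : (x \in square_summable) = (sqsum x \is a fin_num).
Proof.
by apply/square_summableP/idP; rewrite ge0_fin_numE// sqsum_ge0.
Qed.

Lemma esumZ_le (c : R) (f : K -> R) : 0 <= c -> (forall a, 0 <= f a) ->
  (\esum_(a in [set: K]) (c * f a)%:E <= c%:E * \esum_(a in [set: K]) (f a)%:E)%E.
Proof.
move=> c0 f0; apply: ge_ereal_sup => _ [A [Afin _] <-].
under eq_fsbigr do rewrite EFinM.
rewrite -ge0_mule_fsumr; last by move=> a; rewrite lee_fin.
rewrite lee_wpmul2l ?lee_fin//; apply: ereal_sup_ubound.
by exists A => //; split.
Qed.

Lemma esumZ (c : R) (f : K -> R) : 0 <= c -> (forall a, 0 <= f a) ->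
  (\esum_(a in [set: K]) (c * f a)%:E = c%:E * \esum_(a in [set: K]) (f a)%:E)%E.
Proof.
move=> c0 f0; apply/eqP; rewrite eq_le esumZ_le//=.
have [->|cn0] := eqVneq c 0.
  by rewrite mul0e; apply: esum_ge0 => a _; rewrite mul0r.
have cp : 0 < c by rewrite lt_def cn0.
rewrite -lee_pdivlMl//; apply: (le_trans _ (@esumZ_le c^-1 (fun a => c * f a) _ _)).
- by apply: le_esum => a _; rewrite mulKf.
- by rewrite invr_ge0.
- by move=> a; rewrite mulr_ge0.
Qed.

Lemma sqsumZ (c : R) x : sqsum (c *: x) = ((c ^+ 2)%:E * sqsum x)%E.
Proof.
rewrite -esumZ ?sqr_ge0//; apply: eq_esum => a _.
by rewrite /= normrM exprMn real_normK ?num_real.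
Qed.

Lemma sqsumD (u v : R) x y : 0 <= u -> 0 <= v ->
  (forall s t : R, (s + t) ^+ 2 <= u * s ^+ 2 + v * t ^+ 2) ->
  (sqsum (x + y)%R <= u%:E * sqsum x + v%:E * sqsum y)%E.
Proof.
move=> u0 v0 uv; rewrite -!esumZ// -esumD; last 2 first.
- by move=> a _; rewrite lee_fin mulr_ge0.
- by move=> a _; rewrite lee_fin mulr_ge0.
apply: le_esum => a _; rewrite -EFinD lee_fin.
by rewrite !real_normK ?num_real//; exact: uv.
Qed.

Lemma square_summable_submod : submod_closed square_summable.
Proof.
split.
  apply/square_summableP; rewrite /sqsum esum1 ?ltry// => a _.
  by rewrite /= normr0 expr0n.
move=> c x y; rewrite !sqsum_fin_num => xfin yfin.
rewrite -sqsum_fin_num; apply/square_summableP.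
apply: (@le_lt_trans _ _ (2%:E * sqsum (c *: x) + 2%:E * sqsum y)%E).
  apply: sqsumD => // s t; have := sqr_ge0 (s - t); nra.
by rewrite sqsumZ ltey_eq !(fin_numD, fin_numM).
Qed.

HB.instance Definition _ :=
  GRing.isSubmodClosed.Build R (K -> R) square_summable square_summable_submod.

End square_sum.

Section ell2.
Variables (R : realType) (K : choiceType).

(* The space l_2(K), with the linear structure of the functions K -> R. *)
Record ell2 := Ell2 {
  ell2_fun :> K -> R ;
  ell2P : ell2_fun \in @square_summable R K }.

HB.instance Definition _ := [isSub for ell2_fun].
HB.instance Definition _ := [Choice of ell2 by <:].
HB.instance Definition _ := [SubChoice_isSubLmodule of ell2 by <:].

End ell2.

Section ell2_norm.
Variables (R : realType) (K : choiceType).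
Implicit Types x y : ell2 R K.

(* A family f of reals indexed by K is summed as the sum of its positive part
   minus the sum of its negative part; both are finite for f = x * y. *)
Definition inner x y : R :=
  let f a := (x a * y a)%:E in
  fine (\esum_(a in [set: K]) f^\+%E a) - fine (\esum_(a in [set: K]) f^\-%E a).

Definition ell2_norm x : R := Num.sqrt (inner x x).

Lemma innerxx x : inner x x = fine (sqsum x).
Proof.
rewrite /inner [X in _ - fine X](_ : _ = 0%E) ?subr0; last first.
  apply: esum1 => a _; rewrite funenegE; apply/max_idPr.
  by rewrite -EFinN lee_fin oppr_le0 -expr2 sqr_ge0.
congr fine; apply: eq_esum => a _; rewrite funeposE real_normK ?num_real//.
by rewrite expr2; apply/max_idPl; rewrite lee_fin -expr2 sqr_ge0.
Qed.

Lemma sqsumE x : sqsum x = (inner x x)%:E.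
Proof. by rewrite innerxx fineK// -sqsum_fin_num ell2P. Qed.

Lemma inner_ge0 x : 0 <= inner x x.
Proof. by rewrite -lee_fin -sqsumE sqsum_ge0. Qed.

Lemma sqr_ell2_norm x : ell2_norm x ^+ 2 = inner x x.
Proof. by rewrite sqr_sqrtr// inner_ge0. Qed.

Lemma ell2_norm_eq0 x : ell2_norm x = 0 -> x = 0.
Proof.
move=> x0; have sx0 : sqsum x = 0%:E by rewrite sqsumE -sqr_ell2_norm x0 expr0n.
apply: val_inj; apply/funext => a /=.
apply/eqP; rewrite -normr_eq0 -sqrf_eq0 eq_le sqr_ge0 andbT -lee_fin -sx0.
apply: ereal_sup_ubound; exists [set a]; first by split => //; exact: finite_set1.
by rewrite fsbig_set1.
Qed.

Lemma ell2_normZ (c : R) x : ell2_norm (c *: x) = `|c| * ell2_norm x.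
Proof.
rewrite /ell2_norm !innerxx [sqsum _]sqsumZ fineM//; last first.
  by rewrite -sqsum_fin_num ell2P.
by rewrite sqrtrM ?sqr_ge0// sqrtr_sqr.
Qed.

Lemma ell2_normD x y : ell2_norm (x + y) <= ell2_norm x + ell2_norm y.
Proof.
have [x0|nx0] := eqVneq (ell2_norm x) 0.
  by rewrite (ell2_norm_eq0 x0) add0r lerDr sqrtr_ge0.
have [y0|ny0] := eqVneq (ell2_norm y) 0.
  by rewrite (ell2_norm_eq0 y0) addr0 lerDl sqrtr_ge0.
have a0 : 0 < ell2_norm x by rewrite lt_def nx0 sqrtr_ge0.
have b0 : 0 < ell2_norm y by rewrite lt_def ny0 sqrtr_ge0.
rewrite -ler_sqr ?nnegrE ?addr_ge0 ?sqrtr_ge0// sqr_ell2_norm.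
move: (sqr_ell2_norm x) (sqr_ell2_norm y) a0 b0.
move: (ell2_norm x) (ell2_norm y) => a b ax bx a0 b0.
have uv (s t : R) : (s + t) ^+ 2 <= (1 + b / a) * s ^+ 2 + (1 + a / b) * t ^+ 2.
  rewrite -subr_ge0 (_ : _ - _ = (b * s - a * t) ^+ 2 / (a * b)).
    by rewrite divr_ge0 ?sqr_ge0// mulr_ge0// ltW.
  by field; rewrite !gt_eqF.
have := sqsumD x y _ _ uv; rewrite !sqsumE.
move=> /(_ (addr_ge0 ler01 (divr_ge0 (ltW b0) (ltW a0)))).
move=> /(_ (addr_ge0 ler01 (divr_ge0 (ltW a0) (ltW b0)))).
rewrite -[X in (X <= _)%E]/(sqsum (x + y)) sqsumE -!EFinM -EFinD lee_fin.
move=> /le_trans; apply.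
rewrite -ax -bx le_eqVlt; apply/orP; left; apply/eqP.
by field; rewrite !gt_eqF.
Qed.

HB.instance Definition _ :=
  Lmodule_isNormed.Build R (ell2 R K) ell2_normD ell2_normZ ell2_norm_eq0.

Definition ell2_dist x y : R := `|x - y|.

Let dist_ge0 x y : 0 <= ell2_dist x y. Proof. exact: normr_ge0. Qed.

Let dist_positivity x y : ell2_dist x y = 0 -> x = y.
Proof. by move/normr0_eq0/eqP; rewrite subr_eq0 => /eqP. Qed.

Let ballEdist x (e : R) : ball x e = [set y | ell2_dist x y < e].
Proof. by rewrite -ball_normE. Qed.

HB.instance Definition _ := @PseudoMetric_isMetric.Build R (ell2 R K)
  ell2_dist dist_ge0 dist_positivity ballEdist.

End ell2_norm.

(* A subset X of a metric space is regarded as a metric space for the inherited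
   metric. *)
Section banakh.
Variables (R : realType) (M : metricType R).
Implicit Type X : set M.

Definition distances X : set R := [set mdist x y | x in X & y in X].

Definition msphere X (c : M) (r : R) : set M := [set x | X x /\ mdist x c = r].

Definition banakh_space X := forall c r, X c -> distances X r ->
  exists x y, msphere X c r = [set x; y] /\ mdist x y = 2 * r.

End banakh.

Section subgroup.
Variable V : zmodType.
Implicit Type X : set V.

Definition subgroup X := X !=set0 /\ (forall x y, X x -> X y -> X (x - y)).

Definition divisible X :=
  forall p x, prime p -> X x -> exists2 y, X y & y *+ p = x.

End subgroup.

Definition banakh_subgroup (R : realType) (K : choiceType)
  (L : set (ell2 R K)) := subgroup L /\ banakh_space L.

(* Main.v *)
(* L is the rational span of vectors x_t chosen by a transfinite recursion of
   length at most the continuum.  Each step realizes a prescribed norm or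
   approximates a prescribed coordinate direction, and keeps the span M of the
   chosen vectors "good": distinct vectors of M of equal norm are opposite, and
   the coordinate k0 is injective on M.  A new vector is taken on a circle in a
   coordinate plane containing the axis of k0; by the second condition every
   nonzero w in M restricts to a nonzero form on this plane.  The circle vectors
   x for which M + Qx is not good thus lie on lines of the plane, indexed by
   fewer than continuum many tuples over M, and each line meets the circle in at
   most two points.  If K is a singleton, L is the whole space. *)
Require Import Defs.
From mathcomp Require Import all_boot all_order all_algebra.
From mathcomp Require Import ring lra.
From mathcomp Require Import all_classical all_reals all_analysis.
From mathcomp Require Import wochoice.

Set Implicit Arguments.
Unset Strict Implicit.
Unset Printing Implicit Defensive.

Import Order.TTheory GRing.Theory Num.Theory.
Import numFieldNormedType.Exports.

Local Open Scope classical_set_scope.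

(** * Well-orders with small initial segments *)

(** A substitute for cardinal comparison: for uncountable [Z], its failure says that [J] has fewer
    elements than [Z]. The factor [nat] absorbs countable bookkeeping. *)
Definition seq_embeds (Z T : Type) (J : set T) :=
  exists e : Z -> seq T * nat,
    injective e /\ forall z, List.Forall J (e z).1.

Lemma ForallP (T : eqType) (J : set T) s :
  List.Forall J s <-> {in s, forall u, J u}.
Proof.
split=> [|Js]; last first.
  elim: s Js => [|u s IHs] Js; constructor.
    by apply: Js; rewrite mem_head.
  by apply: IHs => v vs; apply: Js; rewrite in_cons vs orbT.
elim=> // u {}s Ju _ IHs v; rewrite in_cons => /predU1P[->//|]; exact: IHs.
Qed.

Section seq_embeds.
Variables (Z : Type) (T : eqType).
Implicit Type J : set T.

Lemma seq_embeds_count (C : countType) J (e : Z -> seq T * C) :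
  injective e -> (forall z, {in (e z).1, forall u, J u}) -> seq_embeds Z J.
Proof.
move=> einj eJ; exists (fun z => ((e z).1, pickle (e z).2)); split.
  move=> y z [e1 /(pcan_inj pickleK) e2]; apply: einj.
  by rewrite [e y]surjective_pairing e1 e2 -surjective_pairing.
by move=> z; apply/ForallP => /=; exact: eJ.
Qed.

Lemma seq_embeds_set0 J : seq_embeds Z J -> (forall u, ~ J u) ->
  countable [set: Z].
Proof.
move=> [e [einj eJ]] J0; apply/countable_injP.
exists (snd \o e) => y z _ _ /= eyz; apply: einj.
have e0 w : (e w).1 = [::].
  case: (e w) (eJ w) => -[//|u s] n /=.
  by move=> /ForallP/(_ u); rewrite mem_head => /(_ isT)/J0.
by rewrite [e y]surjective_pairing [e z]surjective_pairing !e0 eyz.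
Qed.

(** Delete [m] from each code and record where each old entry sits in the shortened sequence. A
    deleted entry gets an out-of-range position, and [nth] with default [m] restores it. *)
Lemma seq_embeds_remove J m : seq_embeds Z J ->
  seq_embeds Z (J `\ m).
Proof.
move=> [e [einj eJ]].
pose s z   := seq.filter (predC1 m) (e z).1.
pose idx z := map (index^~ (s z)) (e z).1.
have idxK z : map (nth m (s z)) (idx z) = (e z).1.
  rewrite /idx -map_comp -[RHS]map_id; apply/eq_in_map => u uz /=.
  have [us|us] := boolP (u \in s z); first by rewrite nth_index.
  rewrite nth_default ?memNindex//; apply/esym/eqP.
  by apply: contraNT us => um; rewrite mem_filter /= um.
apply: (@seq_embeds_count _ _ (fun z => (s z, (idx z, (e z).2)))).
  move=> y z [sE iE nE]; apply: einj.
  by rewrite [e y]surjective_pairing [e z]surjective_pairing -!idxK sE iE nE.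
move=> z u; rewrite mem_filter => /andP[/eqP um uz]; split=> //.
exact: (ForallP _ _).1 (eJ z) u uz.
Qed.

End seq_embeds.

(** Codes of codes are concatenated; the block lengths and the labels are countable data that undo
    the concatenation. *)
Lemma seq_embeds_flatten (Z : Type) (T : eqType) (J : set T)
    (S : eqType) (A : set S) (h : S -> seq T * nat) :
  injective h -> (forall a, A a -> List.Forall J (h a).1) ->
  seq_embeds Z A -> seq_embeds Z J.
Proof.
move=> hinj hJ [e [einj eA]].
pose ss z := map (fst \o h) (e z).1.
pose ns z := map (snd \o h) (e z).1.
apply: (@seq_embeds_count _ _ _ J
  (fun z => (flatten (ss z), (shape (ss z), ns z, (e z).2)))).
  move=> y z [sE shE nE eE]; apply: einj.
  rewrite [e y]surjective_pairing [e z]surjective_pairing eE; congr pair.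
  apply: (inj_map hinj).
  have zipE w : map h (e w).1 = zip (ss w) (ns w).
    rewrite /ss /ns; elim: (e w).1 => //= a s ->.
    by rewrite -surjective_pairing.
  by rewrite !zipE -[ss y]flattenK sE shE flattenK nE.
move=> z u /flattenP[s /mapP[a az ->]] uh.
by move: u uh; apply/ForallP/hJ; exact: (ForallP _ _).1 (eA z) a az.
Qed.

Lemma well_order_min (T : eqType) (le : rel T) (A : set T) :
  well_order le -> A !=set0 -> exists2 m, A m & forall u, A u -> le m u.
Proof.
move=> lewo [a Aa]; have [|m [[mA mmin] _]] := lewo [pred u | `[< A u >]].
  by exists a; apply/asboolP.
by exists m; [exact/asboolP|move=> u Au; apply: mmin; apply/asboolP].
Qed.

Lemma well_order_total (T : eqType) (le : rel T) :
  well_order le -> total_order le.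
Proof.
move=> lewo.
have lewo' : wo_chain le [pred _ : T | true] by move=> A _; exact: lewo.
have le_total : total le by move=> u v; exact: (wo_chainW lewo').
have le_anti : antisymmetric le.
  by move=> u v; exact: (wo_chain_antisymmetric lewo').
split=> //; split=> //; split; first by move=> u; case/orP: (le_total u u).
(* Transitivity: if the least of the three is not [u], antisymmetry identifies two consecutive
   ones. *)
move=> v u w uv vw; have [|m mA mmin] := @well_order_min _ _ [set u; v; w] lewo.
  by exists u; left; left.
have mu : le m u by apply: mmin; left; left.
have mv : le m v by apply: mmin; left; right.
have mw : le m w by apply: mmin; right.
case: mA => [[mE|mE]|mE]; rewrite mE in mu mv mw => //.
- by rewrite (le_anti u v)// uv.
- by rewrite -(le_anti v w)// vw.
Qed.

(* The index set of the transfinite recursion.  No cardinal arithmetic is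
   needed: if I is the least initial segment of a well-order of Z such that Z
   embeds in the finite sequences over I (times nat), then T consists of these
   sequences, compared first by their largest entry. *)
Lemma short_well_order (Z : choiceType) : ~ countable [set: Z] ->
  exists (T : eqType) (lt : T -> T -> Prop) (g : nat * Z -> T),
    [/\ well_founded lt, forall t u v, lt t u -> lt u v -> lt t v,
        forall t u, t = u \/ lt t u \/ lt u t, injective g &
        forall t, ~ seq_embeds Z [set u | lt u t]].
Proof.
move=> Zunc.
have [le lewo] := well_ordering_principle Z.
have [[[lexx le_trans] le_anti] le_total] := well_order_total lewo.
pose D m := [set u | le u m].
(* [I] is [D m] without [m] for the least [m] such that [Z] embeds over [D m], or all of [Z] if
   there is no such [m]. *)
have [I [embI smallI]] : exists I : set Z, seq_embeds Z I /\
    forall u, I u -> ~ seq_embeds Z (D u).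
  have [[m0 Dm0]|nD] := pselect (exists m, seq_embeds Z (D m)); last first.
    exists setT; split; last by move=> u _ Du; apply: nD; exists u.
    apply: (@seq_embeds_count _ _ nat _ (fun z => ([:: z], 0))) => //.
    by move=> y z [].
  have [|m Dm mmin] := @well_order_min _ _ [set m | seq_embeds Z (D m)] lewo.
    by exists m0.
  exists (D m `\ m); split; first exact: seq_embeds_remove.
  by move=> u [um nu] Du; apply: nu; apply: le_anti; rewrite um mmin.
have [w0 Iw0] : I !=set0.
  apply: contrapT => /set0P/negP/negPn/eqP I0; apply: Zunc.
  by apply: (seq_embeds_set0 embI) => u; rewrite I0.
pose max u v := if le u v then v else u.
(* The base value [w0] keeps [mu] of the empty sequence inside [I]. *)
pose mu (p : seq Z * nat) := foldr max w0 p.1.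
have mu_ub p u : u \in p.1 -> le u (mu p).
  rewrite /mu; elim: p.1 => //= v s IHs; rewrite in_cons /max.
  case: ifPn => [vs /predU1P[->//|/IHs//]|vs].
  move=> /predU1P[->//|/IHs us]; apply: (le_trans _ _ _ us).
  by case/orP: (le_total v (foldr max w0 s)) => // vs'; rewrite vs' in vs.
have mu_I p : List.Forall I p.1 -> I (mu p).
  by rewrite /mu; elim=> //= u s Iu _ Is; rewrite /max; case: ifP.
pose T : eqType := {p : seq Z * nat | `[< List.Forall I p.1 >]}.
have [le2 le2wo] := well_ordering_principle T.
have [[[_ le2_trans] le2_anti] le2_total] := well_order_total le2wo.
pose lt (p q : T) := (mu (val p) <> mu (val q) /\ le (mu (val p)) (mu (val q)))
  \/ [/\ mu (val p) = mu (val q), p <> q & le2 p q].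
have [e [einj eI]] := embI.
(* Storing [p.1] in the numerical label fits countably many copies of [Z] into [T]. *)
have gP (p : nat * Z) :
    `[< List.Forall I ((e p.2).1, pickle (p.1, (e p.2).2)).1 >].
  by apply/asboolP; exact: eI.
exists T, lt, (fun p => exist _ ((e p.2).1, pickle (p.1, (e p.2).2)) (gP p)).
split.
- move=> t; apply: contrapT => nt.
  have [|p [q nq <-] pmin] := @well_order_min _ _
    [set mu (val q) | q in [set q | ~ Acc lt q]] lewo.
    by exists (mu (val t)); exists t.
  have [|r [nr rq] rmin] := @well_order_min _ _
    [set r | ~ Acc lt r /\ mu (val r) = mu (val q)] le2wo; first by exists q.
  apply: nr; constructor => s; rewrite /lt rq => -[[sq]|[sq sr]].
    move=> sq'; apply: contra_notP sq => ns; apply: le_anti.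
    by rewrite sq' pmin//; exists s.
  by move=> sr'; apply: contra_notP sr => ns; apply: le2_anti; rewrite sr' rmin.
- move=> t u v [[tu tu']|[tu tu' tu'']] [[uv uv']|[uv uv' uv'']].
  + left; split; last exact: le_trans tu' uv'.
    by move=> tv; apply: tu; apply: le_anti; rewrite tu' tv.
  + by left; rewrite -uv.
  + by left; rewrite tu.
  + right; split; first exact: etrans uv.
      by move=> tv; apply: tu'; apply: le2_anti; rewrite tu'' tv.
    exact: le2_trans tu'' uv''.
- move=> t u; have [->|tu] := pselect (t = u); first by left.
  right; have [mtu|mtu] := pselect (mu (val t) = mu (val u)).
    case/orP: (le2_total t u) => ?; [left|right]; right; split => //.
    by move=> ut; apply: tu.
  by case/orP: (le_total (mu (val t)) (mu (val u))) => ?;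
    [left|right]; left; split => // ?; exact: mtu.
- move=> [m y] [n z] [] eyz1 /(pcan_inj pickleK) [mn eyz2].
  congr pair => //; apply: einj.
  by rewrite [e y]surjective_pairing [e z]surjective_pairing eyz1 eyz2.
(* Predecessors of [t] are sequences over [D (mu (val t))], so an embedding over them would flatten
   to one over that set, against [smallI]. *)
- move=> t; have /smallI := mu_I (val t) (elimT (asboolP _) (valP t)).
  apply: contra_not; apply: (seq_embeds_flatten val_inj) => s st.
  apply/ForallP => u us; apply: (le_trans (mu (val s))); first exact: mu_ub.
  by case: st => [[_]//|[-> _ _]]; exact: lexx.
Qed.

(** * Coordinates in l_2(K) *)

Local Open Scope ring_scope.

Section ell2_coordinates.
Variables (R : realType) (K : choiceType).
Implicit Types (x y : ell2 R K) (a b : K) (c : R).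

Lemma ell2_ext x y : (forall a, x a = y a) -> x = y.
Proof. by move=> xy; apply: val_inj; apply/funext. Qed.

Lemma ell2DE x y a : (x + y) a = x a + y a. Proof. by []. Qed.
Lemma ell2NE x a : (- x) a = - x a. Proof. by []. Qed.
Lemma ell2ZE c x a : (c *: x) a = c * x a. Proof. by []. Qed.
Lemma ell20E a : (0 : ell2 R K) a = 0. Proof. by []. Qed.

Lemma sqsum_coord (f : K -> R) a :
  sqsum f = ((f a ^+ 2)%:E + \esum_(b in ~` [set a]) (`|f b| ^+ 2)%:E)%E.
Proof.
rewrite /sqsum (esumID [set a]);
  last by move=> b _; rewrite lee_fin sqr_ge0.
rewrite !setTI esum_set1; last by rewrite lee_fin sqr_ge0.
by rewrite real_normK ?num_real.
Qed.

Lemma unit_vec_subproof a : (fun b => (b == a)%:R) \in @square_summable R K.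
Proof.
apply/square_summableP; rewrite (sqsum_coord _ a) esum1 ?adde0 ?ltry//.
by move=> b /eqP/negPf ->; rewrite normr0 expr0n.
Qed.

Definition unit_vec a : ell2 R K := Ell2 (unit_vec_subproof a).

Lemma unit_vecE a b : unit_vec a b = (b == a)%:R. Proof. by []. Qed.

Lemma sqr_normE x : `|x| ^+ 2 = inner x x.
Proof. exact: sqr_ell2_norm. Qed.

(** The sum [rest] over the other coordinates is finite and common to both sides, so norm
    computations become polynomial identities. *)
Lemma sqr_normD_unit_vec x c a :
  `|x + c *: unit_vec a| ^+ 2 = `|x| ^+ 2 + 2 * c * x a + c ^+ 2.
Proof.
pose rest := (\esum_(b in ~` [set a]) (`|x b| ^+ 2)%:E)%E.
have Ex : sqsum x = ((x a ^+ 2)%:E + rest)%E by exact: sqsum_coord.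
have Ey : sqsum (x + c *: unit_vec a)%R = (((x a + c) ^+ 2)%:E + rest)%E.
  rewrite (sqsum_coord _ a) ell2DE ell2ZE unit_vecE eqxx mulr1; congr (_ + _)%E.
  apply: eq_esum => b /eqP/negPf ba.
  by rewrite ell2DE ell2ZE unit_vecE ba mulr0 addr0.
move: Ex Ey; rewrite !sqsumE -!sqr_normE; case: rest => //= s [->] [->]; ring.
Qed.

Lemma norm_unit_vec a : `|unit_vec a| = 1.
Proof.
have := sqr_normD_unit_vec 0 1 a; rewrite scale1r add0r normr0 ell20E.
rewrite expr0n mulr0 !add0r expr1n => /eqP; rewrite sqrf_eq1 => /orP[/eqP//|].
by move=> /eqP h; have := normr_ge0 (unit_vec a); rewrite h oppr_ge0 ler10.
Qed.

Lemma norm_truncation x (s : seq K) : uniq s ->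
  `|x - \sum_(a <- s) x a *: unit_vec a| ^+ 2 =
  `|x| ^+ 2 - \sum_(a <- s) x a ^+ 2.
Proof.
elim: s => [|a s IHs] /=; first by rewrite !big_nil !subr0.
move=> /andP[nas us]; rewrite !big_cons opprD addrCA addrC -scaleNr.
rewrite sqr_normD_unit_vec IHs// ell2DE ell2NE.
have -> : (\sum_(b <- s) x b *: unit_vec b) a = 0.
  elim: s nas {us IHs} => [|b s IHs]; rewrite ?big_nil// in_cons negb_or.
  move=> /andP[/negPf ab nas].
  by rewrite big_cons ell2DE ell2ZE unit_vecE ab mulr0 add0r IHs.
ring.
Qed.

Lemma norm_truncation_lt x (e : R) : 0 < e ->
  exists s : seq K, `|x - \sum_(a <- s) x a *: unit_vec a| < e.
Proof.
move=> e0; have xfin : (sqsum x \is a fin_num) by rewrite sqsumE.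
have [_ [A [Afin _] <-]] := ub_ereal_sup_adherent (exprn_gt0 2 e0) xfin.
rewrite -[ereal_sup _]/(sqsum x) sqsumE -sqr_normE fsbig_finite//.
rewrite sumEFin lte_fin => lt.
exists (finmap.enum_fset (fset_set A)).
rewrite -ltr_sqr ?nnegrE ?normr_ge0 ?(ltW e0)//.
rewrite norm_truncation ?finmap.fset_uniq//.
by move: lt; under eq_bigr do rewrite real_normK ?num_real//; lra.
Qed.

Definition rat_subspace (L : set (ell2 R K)) :=
  L 0 /\ forall q y z, L y -> L z -> L (ratr q *: y + z).

Lemma rat_subspaceZ (L : set (ell2 R K)) q y :
  rat_subspace L -> L y -> L (ratr q *: y).
Proof. by move=> [L0 LP] Ly; rewrite -[X in L X]addr0; exact: LP. Qed.

Lemma rat_subspaceD (L : set (ell2 R K)) y z :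
  rat_subspace L -> L y -> L z -> L (y + z).
Proof.
by move=> [_ LP] Ly Lz; have := LP 1 _ _ Ly Lz; rewrite rmorph1 scale1r.
Qed.

Lemma rat_subspaceB (L : set (ell2 R K)) y z :
  rat_subspace L -> L y -> L z -> L (y - z).
Proof.
move=> LP Ly Lz; apply: rat_subspaceD => //.
by have := rat_subspaceZ (-1) LP Lz; rewrite rmorphN rmorph1 scaleN1r.
Qed.

(** By truncation it suffices to approximate each [c *: unit_vec a]. The multiple [ratr q *: v] with
    [q] near [c / rho] does so, since the error of [v] is relative to [rho]. *)
Lemma rat_subspace_dense (L : set (ell2 R K)) : rat_subspace L ->
  (forall a n, exists2 rho : R, 0 < rho &
     exists2 v, L v & `|v - rho *: unit_vec a| < rho / n.+1%:R) ->
  dense L.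
Proof.
move=> LP Lunit.
have LunitZ c a (e : R) : 0 < e -> exists2 v, L v & `|c *: unit_vec a - v| < e.
  move=> e0.
  (* With this [n] the error of [v] contributes less than [e / 2]; rounding [c / rho] to [q] costs
     at most [e / 4] in each of two places. *)
  have [n] : exists n, (2 * `|c| / e < n%:R).
    exists (Num.bound (2 * `|c| / e)); apply: archi_boundP.
    by rewrite divr_ge0// ?mulr_ge0// ltW.
  rewrite ltr_pdivrMr// => ne.
  have [rho rho0 [v Lv vrho]] := Lunit a n.
  pose eta := e / 4 / rho.
  have eta0 : 0 < eta by rewrite !divr_gt0.
  have /rat_in_itvoo[q] : c / rho - eta < c / rho + eta by lra.
  rewrite in_itv/= => /andP[q1 q2].
  exists (ratr q *: v); first exact: rat_subspaceZ.
  rewrite [X in `|X|](_ : _ =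
    (c - ratr q * rho) *: unit_vec a - ratr q *: (v - rho *: unit_vec a)); last first.
    by rewrite scalerBr scalerBl scalerA opprB addrA subrK.
  apply: (le_lt_trans (ler_normB _ _)).
  rewrite (normrZ (c - _)) (normrZ (ratr q)) norm_unit_vec mulr1.
  have cq : `|c - ratr q * rho| < e / 4.
    have etaE : e / 4 = eta * rho by rewrite divfK ?gt_eqF.
    have cE : c = c / rho * rho by rewrite divfK ?gt_eqF.
    rewrite {1}cE etaE -mulrBl normrM (gtr0_norm rho0) ltr_pM2r//.
    by rewrite ltr_norml; apply/andP; split; lra.
  have qrho : `|ratr q| * rho < `|c| + e / 4.
    rewrite -[rho in X in X < _](gtr0_norm rho0) -normrM.
    have := ler_normB c (c - ratr q * rho); rewrite opprB addrC subrK.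
    lra.
  have qv : `|ratr q| * `|v - rho *: unit_vec a| <= (`|c| + e / 4) / n.+1%:R.
    apply: (@le_trans _ _ (`|ratr q| * (rho / n.+1%:R))).
      by rewrite ler_wpM2l// ltW.
    by rewrite mulrA ler_wpM2r ?invr_ge0// ltW.
  have : (`|c| + e / 4) / n.+1%:R < e / 2 + e / 4.
    rewrite ltr_pdivrMr ?ltr0Sn// -[n.+1%:R]natr1.
    have := normr_ge0 c; lra.
  by move=> /(le_lt_trans qv)/(ltrD cq)/lt_le_trans; apply; lra.
move=> O [x Ox] Oopen.
have [e /= e0 eO] : exists2 e : R, 0 < e & ball x e `<=` O.
  by apply/nbhs_ballP; exact: open_nbhs_nbhs.
have [s xs] := norm_truncation_lt x (divr_gt0 e0 (ltr0Sn R 1)).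
have [v Lv vs] : exists2 v, L v & `|\sum_(a <- s) x a *: unit_vec a - v| < e / 2.
  elim: s (e / 2) (divr_gt0 e0 (ltr0Sn R 1)) {xs} => [|a s IHs] d d0.
    by exists 0; [exact: LP.1|rewrite big_nil subr0 normr0].
  have d20 : 0 < d / 2 by rewrite divr_gt0.
  have [v Lv vs] := IHs _ d20; have [w Lw wa] := LunitZ (x a) a _ d20.
  exists (w + v); first exact: rat_subspaceD.
  rewrite big_cons opprD addrACA.
  by apply: (le_lt_trans (ler_normD _ _)); lra.
exists v; split=> //; apply: eO; rewrite -ball_normE /= -(subrK
  (\sum_(a <- s) x a *: unit_vec a) x) -addrA.
by apply: (le_lt_trans (ler_normD _ _)); lra.
Qed.

End ell2_coordinates.

(** * Adjoining one vector *)

Section circle.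
Variable R : rcfType.
Implicit Types (A B C t r c : R).

Definition quad_root A B C (s : bool) : R :=
  if A == 0 then - C / B
  else (- B + (-1) ^+ s * Num.sqrt (B ^+ 2 - 4 * A * C)) / (2 * A).

Lemma quad_rootP A B C t : [|| A != 0, B != 0 | C != 0] ->
  A * t ^+ 2 + B * t + C = 0 -> exists s, t = quad_root A B C s.
Proof.
rewrite /quad_root; have [->|A0] /= := eqVneq A 0.
  rewrite mul0r add0r; have [->|B0] /= := eqVneq B 0.
    by rewrite mul0r add0r => /eqP.
  move=> _ /eqP; rewrite addr_eq0 => /eqP <-.
  by exists false; rewrite mulrC mulKf.
move=> _ tE; set D := B ^+ 2 - _.
have DE : (2 * A * t + B) ^+ 2 = D.
  by rewrite -[LHS]subr0 -(mulr0 (4 * A)) -tE /D; ring.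
have [s sE] : exists s : bool, 2 * A * t + B = (-1) ^+ s * Num.sqrt D.
  rewrite -DE sqrtr_sqr; exists (2 * A * t + B < 0).
  by rewrite mulr_sign; case: ltrP => [/ltr0_norm->|/ger0_norm//]; rewrite opprK.
exists s; rewrite -sE [- B + _]addrC addrK mulrC mulKf//.
by rewrite mulf_neq0// pnatr_eq0.
Qed.

(** The quadratic in [t] is [r ^+ 2 * (u + t * v) ^+ 2 - c ^+ 2 * (1 + t ^+ 2)], obtained by
    squaring the equation of the line. *)
Definition circle_root r u v c : bool -> R :=
  quad_root (r ^+ 2 * v ^+ 2 - c ^+ 2) (2 * r ^+ 2 * u * v)
            (r ^+ 2 * u ^+ 2 - c ^+ 2).

(* The points (1, t) r / sqrt (1 + t^2) run through a half circle, which meets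
   a line in at most two points. *)
Lemma circle_rootP r u v c t : 0 < r -> (u != 0) || (v != 0) ->
  r / Num.sqrt (1 + t ^+ 2) * (u + t * v) = c ->
  exists s, t = circle_root r u v c s.
Proof.
move=> r0 uv cE; have h0 : 0 < 1 + t ^+ 2 by rewrite ltr_pwDl// sqr_ge0.
have c2E : r ^+ 2 * (u + t * v) ^+ 2 = c ^+ 2 * (1 + t ^+ 2).
  rewrite -cE !exprMn exprVn sqr_sqrtr ?(ltW h0)//.
  by field; rewrite gt_eqF.
apply: quad_rootP; last first.
  transitivity (r ^+ 2 * (u + t * v) ^+ 2 - c ^+ 2 * (1 + t ^+ 2)); first ring.
  by rewrite c2E subrr.
(* If all coefficients vanish, then [u ^+ 2 = v ^+ 2] and [u * v = 0], hence [u = v = 0]. *)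
apply: contraTT uv; rewrite !negb_or !negbK !subr_eq0.
move=> /and3P[/eqP vc uv /eqP].
rewrite -vc => /(mulfI (lt0r_neq0 (exprn_gt0 2 r0)))/eqP; rewrite eqf_sqr.
move: uv; rewrite !mulf_eq0 pnatr_eq0 !(gt_eqF r0)/=.
by case/orP => /eqP->; rewrite ?oppr0 ?(eq_sym 0) ?oppr_eq0 ?orbb => /eqP->;
  rewrite eqxx.
Qed.

End circle.

Section adjoin.
Variables (R : realType) (K : choiceType) (k0 : K).
Implicit Types (M : set (ell2 R K)) (x y z : ell2 R K).

Definition adjoin M x :=
  [set v | exists q, exists2 y, M y & v = y + ratr q *: x].

(* The first condition keeps every nonzero vector of M from being orthogonal to
   the vectors [unit_vec a + t *: unit_vec b] with k0 in {a, b}, up to finitely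
   many t. *)
Definition good M := (forall y, M y -> y k0 = 0 -> y = 0) /\
  (forall y z, M y -> M z -> `|y| = `|z| -> y = z \/ y = - z).

(** The circle vector has norm [r] for every [t], so equating two such norms gives a condition
    linear in that vector. *)
Lemma norm_circle a b (r t : R) y q : a != b -> 0 < r ->
  `|y + q *: ((r / Num.sqrt (1 + t ^+ 2)) *:
              (unit_vec R a + t *: unit_vec R b))| ^+ 2 =
  `|y| ^+ 2 + 2 * q * (r / Num.sqrt (1 + t ^+ 2) * (y a + t * y b))
  + q ^+ 2 * r ^+ 2.
Proof.
move=> ab r0; have h0 : 0 < 1 + t ^+ 2 by rewrite ltr_pwDl// sqr_ge0.
have : r ^+ 2 = (r / Num.sqrt (1 + t ^+ 2)) ^+ 2 * (1 + t ^+ 2).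
  by rewrite exprMn exprVn sqr_sqrtr ?(ltW h0)// divfK ?gt_eqF.
move: (r / _) => m ->.
rewrite (scalerDr m) (scalerA m) (scalerDr q) !(scalerA q) addrA.
rewrite 2!sqr_normD_unit_vec ell2DE ell2ZE unit_vecE.
rewrite [b == a]eq_sym (negPf ab); rewrite mulr0 addr0; ring.
Qed.

(** Equal norms of [y + p x] and [z + q x] put [x] on a line with normal [w = p y - q z], which the
    last hypothesis excludes if [w] is nonzero. If [w = 0] and [p] is nonzero, then [y = (q / p) z],
    the linear terms cancel, and either [q = p] or [q = - p], or [z] has norm [|p| r], impossible in
    [M]. *)
Lemma good_adjoin M a b (r t : R) :
  rat_subspace M -> good M -> a != b -> (k0 == a) || (k0 == b) -> 0 < r ->
  (forall y, M y -> `|y| <> r) ->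
  (forall y s, M y ->
    t <> circle_root r (unit_vec R a k0) (unit_vec R b k0) (y k0) s) ->
  (forall y z p q s, M y -> M z ->
    let w := ratr p *: y - ratr q *: z in
    t <> circle_root r (2 * w a) (2 * w b)
      (`|z| ^+ 2 - `|y| ^+ 2 + (ratr q ^+ 2 - ratr p ^+ 2) * r ^+ 2) s) ->
  good (adjoin M
    ((r / Num.sqrt (1 + t ^+ 2)) *: (unit_vec R a + t *: unit_vec R b))).
Proof.
move=> MP [M1 M2] ab k0ab r0 Mr tk tw.
have MZ q y : M y -> M (ratr q *: y) by exact: rat_subspaceZ.
set m := r / _; set x := _ *: (_ + _).
have ratr_eq0 (q : rat) : (ratr q == 0 :> R) = (q == 0) by exact: fmorph_eq0.
(* Rescaling by [q^-1] extends the exclusion of the norm [r] to its nonzero rational multiples. *)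
have MrZ q y : M y -> q != 0 -> `|y| ^+ 2 <> ratr q ^+ 2 * r ^+ 2.
  move=> My q0 yq; apply: (Mr (ratr q^-1 *: y)); first exact: MZ.
  apply/eqP; rewrite -(eqrXn2 (n := 2))// ?(ltW r0)//.
  rewrite normrZ exprMn yq real_normK ?num_real// fmorphV exprVn mulKf//.
  by rewrite expf_neq0// ratr_eq0.
split=> [_ [q [y My ->]]|].
  rewrite ell2DE ell2ZE; have [->|q0] := eqVneq q 0.
    by rewrite rmorph0 mul0r scale0r !addr0; exact: M1.
  move=> /eqP; rewrite addrC addr_eq0 => /eqP xy.
  (* A vanishing [k0]-coordinate of [y + q x] makes that of [x] equal to that of a vector of [M]. *)
  have [||s ts] := @circle_rootP _ r (unit_vec R a k0) (unit_vec R b k0)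
      ((ratr (- q^-1) *: y) k0) t r0.
    by rewrite !unit_vecE; case/orP: k0ab => ->; rewrite ?orbT oner_neq0 ?orbT.
    rewrite -[LHS]/(x k0) [RHS]ell2ZE rmorphN fmorphV mulNr -mulrN -xy mulKf//.
    by rewrite ratr_eq0.
  by case: (tk _ s (MZ _ _ My) ts).
move=> _ _ [p [y My ->]] [q [z Mz ->]] /(congr1 (fun u => u ^+ 2)) yz.
have {}yz := etrans (esym (norm_circle t y (ratr p) ab r0))
  (etrans yz (norm_circle t z (ratr q) ab r0)).
rewrite -/m in yz.
pose w := ratr p *: y - ratr q *: z.
have Mw : M w by apply: rat_subspaceB => //; exact: MZ.
have [w0|w0] := eqVneq w 0; last first.
  have [||s ts] := @circle_rootP _ r (2 * w a) (2 * w b)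
      (`|z| ^+ 2 - `|y| ^+ 2 + (ratr q ^+ 2 - ratr p ^+ 2) * r ^+ 2) t r0.
    (* As [k0] is [a] or [b], injectivity of this coordinate on [M] makes the line nondegenerate. *)
    rewrite !mulf_eq0 pnatr_eq0/= -negb_and; apply: contra_neqN w0.
    move=> /andP[/eqP wa /eqP wb]; apply: M1 => //.
    by case/orP: k0ab => /eqP ->.
    rewrite -/m /w !(ell2DE, ell2NE, ell2ZE); lra.
  by case: (tw y z p q s My Mz ts).
move/eqP: w0; rewrite subr_eq0 => /eqP pyqz.
have [p0|p0] := eqVneq p 0.
  move: pyqz yz; rewrite p0 rmorph0 !scale0r addr0.
  have [->|q0] := eqVneq q 0.
    rewrite rmorph0 !scale0r !addr0 expr0n/= !mulr0 !mul0r !addr0 => _ /eqP.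
    by rewrite eqrXn2// => /eqP; exact: M2.
  move=> /esym/eqP; rewrite scaler_eq0 ratr_eq0 (negPf q0) => /eqP ->.
  rewrite normr0 !ell20E expr0n/= !(mulr0, mul0r, addr0, add0r) => yq.
  by case: (MrZ q y).
have yE : y = ratr (q / p) *: z.
  apply: (scalerI (a := ratr p)); first by rewrite ratr_eq0.
  by rewrite pyqz scalerA -rmorphM mulrC divfK.
have [qp|qp] := eqVneq (q ^+ 2) (p ^+ 2).
  move/eqP: qp; rewrite eqf_sqr => /orP[] /eqP qp; move: yE; rewrite qp.
    by rewrite divff// rmorph1 scale1r => ->; left.
  rewrite mulNr divff// rmorphN rmorph1 scaleN1r => ->; right.
  by rewrite rmorphN scaleNr opprD opprK.
have P0 : ratr p != 0 :> R by rewrite ratr_eq0.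
have QP : ratr q ^+ 2 - ratr p ^+ 2 != 0 :> R.
  by rewrite subr_eq0 -!rmorphXn fmorph_eq.
have yN : `|y| ^+ 2 = (ratr q / ratr p) ^+ 2 * `|z| ^+ 2.
  by rewrite yE normrZ exprMn real_normK ?num_real// fmorph_div.
case: (MrZ p z) => //; move: yz.
have yk k : y k = ratr q / ratr p * z k by rewrite yE ell2ZE fmorph_div.
rewrite yN !yk => yz; apply: (mulfI QP).
move: yz P0; move: (ratr p) (ratr q) (`|z| ^+ 2) (z a) (z b) => P Q Z za zb.
move=> /eqP; rewrite -subr_eq0 => /eqP yz P0; apply: subr0_eq.
rewrite -(mulr0 (P ^+ 2)) -yz; by field.
Qed.

End adjoin.

(** * The recursion *)

Lemma real_uncountable (R : realType) : ~ countable [set: R].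
Proof.
move=> /(sub_countable (subset_card_le (@subsetT _ `[0, 1]%classic))).
move=> /countable_lebesgue_measure0.
rewrite lebesgue_measure_itv/= lte_fin ltr01.
by rewrite oppr0 adde0 => /eqP; rewrite eqe oner_eq0.
Qed.

(** * Rational spans and avoidance of few values *)

Section rat_span.
Variables (R : realType) (K : choiceType) (T : eqType).
Implicit Types (x : T -> ell2 R K) (J : set T) (s : seq (rat * T)).

(** Lists of pairs, with repetitions allowed, make a vector of the span a finite sequence of indices
    together with countable data. *)
Definition rat_comb x s : ell2 R K := \sum_(p <- s) ratr p.1 *: x p.2.

Definition rat_span x J :=
  [set rat_comb x s | s in [set s : seq (rat * T) | {in s, forall p, J p.2}]].

Lemma rat_span_subspace x J : rat_subspace (rat_span x J).
Proof.
split; first by exists [::] => //; rewrite /rat_comb big_nil.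
move=> q _ _ [s sJ <-] [s' sJ' <-].
exists ([seq (q * p.1, p.2) | p <- s] ++ s').
  move=> p; rewrite mem_cat => /orP[/mapP[p' /sJ Jp ->]//|]; exact: sJ'.
rewrite /rat_comb big_cat big_map/= scaler_sumr; congr (_ + _).
by apply: eq_bigr => p _; rewrite rmorphM scalerA.
Qed.

Lemma eq_rat_span x y J : {in J, x =1 y} -> rat_span x J `<=` rat_span y J.
Proof.
move=> xy _ [s sJ <-]; exists s => //; rewrite /rat_comb !big_seq.
by apply: eq_bigr => p ps; rewrite xy// inE; exact: sJ.
Qed.

Lemma rat_span_adjoin x J J' t : (forall u, J' u -> u = t \/ J u) ->
  rat_span x J' `<=` adjoin (rat_span x J) (x t).
Proof.
move=> J'J _ [s sJ <-]; elim: s sJ => [|p s IHs] sJ.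
  exists 0, 0; first exact: (rat_span_subspace x J).1.
  by rewrite /rat_comb big_nil rmorph0 scale0r addr0.
have [|q [y yJ E]] := IHs.
  by move=> p' p's; apply: sJ; rewrite in_cons p's orbT.
rewrite /rat_comb big_cons -/(rat_comb x s) E.
case: (J'J p.2) => [|->|Jp]; first by apply: sJ; rewrite mem_head.
  by exists (q + p.1), y => //; rewrite rmorphD scalerDl [RHS]addrA addrC.
exists q, (ratr p.1 *: x p.2 + y); last by rewrite addrA.
apply: (rat_span_subspace x J).2 => //.
exists [:: (1, p.2)]; first by move=> p'; rewrite inE => /eqP ->.
by rewrite /rat_comb big_seq1 rmorph1 scale1r.
Qed.

(** If every point of the interval were a value of [f], coding each by two index lists, their
    coefficients and [c] would embed [R] over [J]. *)
Lemma rat_span_avoid x J (C : countType) (f : ell2 R K -> ell2 R K -> C -> R)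
    (d : R) : ~ seq_embeds R J -> 0 < d ->
  exists2 t, 0 < t < d &
    forall y z c, rat_span x J y -> rat_span x J z -> t <> f y z c.
Proof.
move=> nemb d0; apply: contrapT => nt; apply: nemb.
(* An injection of the whole line into the interval from 0 to [d]. *)
pose th (u : R) := d / (1 + expR u).
have e0 (u : R) : 0 < 1 + expR u by rewrite addr_gt0// expR_gt0.
have th_itv u : 0 < th u < d.
  by rewrite divr_gt0//= ltr_pdivrMr// ltr_pMr// ltrDl expR_gt0.
have th_inj : injective th.
  move=> u v /(mulfI (lt0r_neq0 d0))/invr_inj/addrI; exact: expR_inj.
have /choice[g gP] : forall u, exists p : seq (rat * T) * seq (rat * T) * C,
    [/\ {in p.1.1, forall q, J q.2}, {in p.1.2, forall q, J q.2} &
        th u = f (rat_comb x p.1.1) (rat_comb x p.1.2) p.2].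
  move=> u; apply: contrapT => nu; apply: nt; exists (th u) => //.
  move=> _ _ c [s sJ <-] [s' sJ' <-] thE.
  by apply: nu; exists (s, s', c).
apply: (@seq_embeds_count _ _ _ J (fun u =>
  (unzip2 (g u).1.1 ++ unzip2 (g u).1.2,
  (unzip1 (g u).1.1, unzip1 (g u).1.2, (g u).2)))).
  move=> u v [E E1 E2 E3]; apply: th_inj.
  have [_ _ ->] := gP u; have [_ _ ->] := gP v.
  (* Equal coefficient lists have equal lengths, which tells where to cut the concatenated index
     lists. *)
  have sz : size (unzip2 (g u).1.1) == size (unzip2 (g v).1.1).
    by rewrite !size_map -(size_map fst) -/unzip1 E1 size_map.
  move/eqP: E; rewrite eqseq_cat ?(eqP sz)// => /andP[/eqP F1 /eqP F2].
  rewrite -(zip_unzip (g u).1.1) -(zip_unzip (g u).1.2) E1 E2 E3 F1 F2.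
  by rewrite !zip_unzip.
by move=> u t; have [J1 J2 _] := gP u;
  rewrite mem_cat => /orP[] /mapP[p ps ->]; [exact: J1|exact: J2].
Qed.

End rat_span.

(** * One step of the recursion *)

Section extension.
Variables (R : realType) (K : choiceType) (k0 : K) (T : eqType).
Variables (x : T -> ell2 R K) (J : set T).
Hypotheses (J_small : ~ seq_embeds R J) (x_good : good k0 (rat_span x J)).

Let M := rat_span x J.

(** The vector is [rho *: (unit_vec a + t *: unit_vec b)] scaled to norm [r]; its relative distance
    to the axis of [a] is [t], so a small [t] off the forbidden roots serves both aims. *)
Lemma good_extension a b (r d : R) : a != b -> (k0 == a) || (k0 == b) ->
  0 < r -> (forall y, M y -> `|y| <> r) -> 0 < d ->
  exists v, [/\ `|v| = r, exists2 rho, 0 < rho &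
    `|v - rho *: unit_vec R a| < rho * d & good k0 (adjoin M v)].
Proof.
move=> ab k0ab r0 Mr d0.
(* [None] lists the roots threatening the coordinate [k0], [Some (p, q)] those threatening the
   norms. *)
pose f (y z : ell2 R K) (c : option (rat * rat) * bool) :=
  if c.1 is Some (p, q) then
    let w := ratr p *: y - ratr q *: z in
    circle_root r (2 * w a) (2 * w b)
      (`|z| ^+ 2 - `|y| ^+ 2 + (ratr q ^+ 2 - ratr p ^+ 2) * r ^+ 2) c.2
  else circle_root r (unit_vec R a k0) (unit_vec R b k0) (y k0) c.2.
have [t /andP[t0 td] tf] := rat_span_avoid x f J_small d0.
have h0 : 0 < 1 + t ^+ 2 by rewrite ltr_pwDl// sqr_ge0.
have m0 : 0 < r / Num.sqrt (1 + t ^+ 2) by rewrite divr_gt0// sqrtr_gt0.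
exists ((r / Num.sqrt (1 + t ^+ 2)) *: (unit_vec R a + t *: unit_vec R b)).
split.
- have := norm_circle t 0 1 ab r0; rewrite add0r scale1r normr0 !ell20E.
  rewrite !mulr0 addr0 !mulr0 expr0n expr1n mul1r !add0r => /eqP.
  by rewrite eqrXn2// ?(ltW r0)// => /eqP.
- exists (r / Num.sqrt (1 + t ^+ 2)) => //.
  rewrite -scalerBr addrAC subrr add0r normrZ gtr0_norm// ltr_pM2l//.
  by rewrite normrZ norm_unit_vec mulr1 gtr0_norm.
- apply: good_adjoin => //; first exact: rat_span_subspace.
  + by move=> y s My; exact: (tf y y (None, s)).
  + by move=> y z p q s My Mz; exact: (tf y z (Some (p, q), s)).
Qed.

Hypothesis k0_neq : exists k, k != k0.

(** A norm already attained in [M], in particular 0, is realized by an old vector, which leaves the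
    span unchanged. *)
Lemma good_extension_norm (r : R) : 0 <= r ->
  exists2 v, `|v| = r & good k0 (adjoin M v).
Proof.
move=> r0; have MP := rat_span_subspace x J.
have [[v Mv vr]|nMr] := pselect (exists2 v, M v & `|v| = r).
  exists v => //; have adj : adjoin M v `<=` M.
    by move=> _ [q [y My ->]]; apply: rat_subspaceD => //; exact: rat_subspaceZ.
  split=> [y /adj|y z /adj My /adj]; [exact: x_good.1|exact: x_good.2].
have {}r0 : 0 < r.
  rewrite lt_def r0 andbT; apply: contra_notN nMr => /eqP ->.
  by exists 0; [exact: MP.1|rewrite normr0].
have [k kk0] := k0_neq.
have [||v [vr _ ?]] := @good_extension k k0 r 1 kk0 _ r0 _ ltr01.
- by rewrite eqxx orbT.
- by move=> y My yr; apply: nMr; exists y.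
by exists v.
Qed.

(** The radius is free here, so it is chosen off the norms of [M]; the second axis is [k0], or any
    other one if [a] is [k0]. *)
Lemma good_extension_direction a (d : R) : 0 < d ->
  exists2 v, exists2 rho, 0 < rho & `|v - rho *: unit_vec R a| < rho * d
  & good k0 (adjoin M v).
Proof.
move=> d0.
have [r /andP[r0 _] Mr] :=
  rat_span_avoid x (fun y _ (_ : unit) => `|y|) J_small (ltr01 : 0 < 1 :> R).
have {}Mr y : M y -> `|y| <> r by move=> My /esym; exact: (Mr y y tt).
have [k ka k0k] : exists2 k, a != k & (k0 == a) || (k0 == k).
  have [k0a|k0a] := eqVneq k0 a; last first.
    by exists k0; rewrite ?eqxx ?orbT// eq_sym.
  by have [k kk0] := k0_neq; exists k; rewrite -?k0a 1?eq_sym.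
by have [v [_ vd ?]] := good_extension ka k0k r0 Mr d0; exists v.
Qed.

End extension.

(** * Transfinite recursion for good spans *)

Section recursion.
Variables (R : realType) (K : choiceType) (k0 : K) (T : eqType).
Variables (lt : T -> T -> Prop) (req : T -> set (ell2 R K)).
Implicit Type x : T -> ell2 R K.
Hypothesis lt_wf : well_founded lt.
Hypothesis lt_trans : forall t u v, lt t u -> lt u v -> lt t v.
Hypothesis lt_total : forall t u, t = u \/ lt t u \/ lt u t.
Hypothesis extend : forall x t, good k0 (rat_span x [set u | lt u t]) ->
  exists2 v, req t v & good k0 (adjoin (rat_span x [set u | lt u t]) v).

(** Goodness constrains at most two vectors at a time, and these involve finitely many indices. *)
Lemma good_directed x (J : set T) :
  (forall s : seq T, {in s, forall u, J u} ->
     exists2 J', good k0 (rat_span x J') & {in s, forall u, J' u}) ->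
  good k0 (rat_span x J).
Proof.
move=> dir.
have dir2 y z : rat_span x J y -> rat_span x J z ->
    exists J', [/\ good k0 (rat_span x J'), rat_span x J' y & rat_span x J' z].
  move=> [s sJ <-] [s' sJ' <-].
  have [|J' gJ' J'P] := dir (unzip2 (s ++ s')).
    by move=> u /mapP[p + ->]; rewrite mem_cat => /orP[/sJ|/sJ'].
  exists J'; split => //.
    by exists s => // p ps; apply: J'P; rewrite map_f// mem_cat ps.
  by exists s' => // p ps; apply: J'P; rewrite map_f// mem_cat ps orbT.
split=> [y Jy|y z Jy Jz].
  by have [J' [[+ _] Jy' _]] := dir2 _ _ Jy Jy; exact.
by have [J' [[_ +] Jy' Jz']] := dir2 _ _ Jy Jz; exact.
Qed.

Lemma good0 x : good k0 (@rat_span R K T x set0).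
Proof.
have z y : rat_span x set0 y -> y = 0.
  move=> [[|p s] sJ <-]; first by rewrite /rat_comb big_nil.
  by case: (sJ p); rewrite mem_head.
by split=> [y /z//|y y' /z -> /z ->]; left.
Qed.

Lemma max_mem (s : seq T) (J : set T) : {in s, forall u, J u} ->
  s = [::] \/ exists2 m, J m & {in s, forall u, u = m \/ lt u m}.
Proof.
elim: s => [|t s IHs] tsJ; [by left|right].
have Jt : J t by apply: tsJ; rewrite mem_head.
case: IHs => [u us|->|[m Jm mP]]; first by apply: tsJ; rewrite in_cons us orbT.
  by exists t => // u; rewrite inE => /eqP; left.
have [tm|mt] : lt t m \/ (t = m \/ lt m t) by case: (lt_total t m); tauto.
  by exists m => // u; rewrite in_cons => /predU1P[->|/mP//]; right.
exists t => // u; rewrite in_cons => /predU1P[->|/mP]; first by left.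
case: mt => [->//|mt [->|um]]; right => //; exact: lt_trans mt.
Qed.

Lemma transfinite_extension :
  exists x, good k0 (rat_span x setT) /\ forall t, req t (x t).
Proof.
pose below t := [set u | lt u t].
(* The partial family is extended by 0 to a total one; only its values below [t] enter the span. *)
pose next t (xt : forall u, lt u t -> ell2 R K) : ell2 R K :=
  let x u := if pselect (lt u t) is left ut then xt u ut else 0 in
  xget 0 [set v | req t v /\ good k0 (adjoin (rat_span x (below t)) v)].
pose x := Fix lt_wf (fun _ => ell2 R K) next.
have xE t : x t = next t (fun u _ => x u).
  rewrite /x Fix_eq// => {}t f g fg; rewrite /next.
  suff -> : f = g by [].
  by apply: functional_extensionality_dep => u; apply: funext.
have xP t : good k0 (rat_span x (below t)) ->
    req t (x t) /\ good k0 (adjoin (rat_span x (below t)) (x t)).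
  move=> /extend[v vt gv]; rewrite xE /next.
  set y := fun u : T => _.
  have yE : rat_span y (below t) = rat_span x (below t).
    by apply/seteqP; split; apply: eq_rat_span => u; rewrite inE /y;
      case: pselect.
  by rewrite yE; case: xgetP => [w _ //|/(_ v)[]].
pose upto t := [set u | u = t \/ lt u t].
(* This is the limit step: a finite set of indices lies below its largest element. *)
have upto_directed (J : set T) :
    (forall u, J u -> good k0 (rat_span x (upto u))) -> good k0 (rat_span x J).
  move=> IH; apply: good_directed => s /max_mem[->|[m Jm mP]].
    by exists set0 => //; exact: good0.
  by exists (upto m); [exact: IH|exact: mP].
have uptoP t : good k0 (rat_span x (upto t)).
  elim/(well_founded_ind lt_wf): t => t IH.
  have [_ [g1 g2]] := xP t (upto_directed _ IH).
  have sub := @rat_span_adjoin _ _ _ x (below t) (upto t) t (fun _ => id).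
  by split=> [y /sub|y z /sub My /sub]; [exact: g1|exact: g2].
exists x; split; first exact: upto_directed.
by move=> t; apply: (xP t _).1; exact: upto_directed.
Qed.

End recursion.

(** * The Banakh property *)

Section banakh.
Variables (R : realType) (K : choiceType) (L : set (ell2 R K)).
Hypothesis L_sub : rat_subspace L.
Hypothesis L_norm : forall y z, L y -> L z -> `|y| = `|z| -> y = z \/ y = - z.
Hypothesis L_surj : forall r : R, 0 <= r -> exists2 v, L v & `|v| = r.

Lemma rat_subspace_divisible : divisible L.
Proof.
move=> p y p_pr Ly; exists (ratr p%:R^-1 *: y).
  exact: (rat_subspaceZ _ L_sub).
rewrite -scaler_nat scalerA fmorphV rmorph_nat mulfV ?scale1r//.
by rewrite pnatr_eq0 -lt0n prime_gt0.
Qed.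

Lemma distances_norm : distances L = [set r : R | 0 <= r].
Proof.
apply/seteqP; split=> [_ [y _ [z _ <-]]|r /L_surj[v Lv vr]].
  exact: (normr_ge0 (y - z)).
exists v => //; exists 0; first exact: L_sub.1.
by rewrite -vr -[RHS]/(`|v|) -[in RHS](subr0 v).
Qed.

(** A distance [r] is the norm of some [w] in [L], and by [L_norm] the only vectors of [L] of norm
    [r] are [w] and [- w]; hence the sphere about [c] is [c + w], [c - w]. *)
Lemma norm_banakh_subgroup : banakh_subgroup L.
Proof.
split.
  by split; [exists 0; exact: L_sub.1|move=> y z; exact: (rat_subspaceB L_sub)].
move=> c r Lc [y Ly [z Lz yzr]]; set w := y - z.
have Lw : L w by exact: (rat_subspaceB L_sub).
have {yzr}wr : `|w| = r by [].
exists (c + w), (c - w); split.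
  apply/seteqP; split=> v /=.
    move=> [Lv vc]; have vcr : `|v - c| = r by [].
    have Lvc : L (v - c) by exact: (rat_subspaceB L_sub).
    have [|vw|vw] := L_norm Lvc Lw; first by rewrite vcr.
      by left; rewrite -vw addrC subrK.
    by right; rewrite -vw addrC subrK.
  move=> [->|->]; split; [exact: (rat_subspaceD L_sub)|
    |exact: (rat_subspaceB L_sub)|].
    by rewrite -[LHS]/(`|c + w - c|) addrC addKr.
  by rewrite -[LHS]/(`|c - w - c|) addrC addKr normrN.
rewrite -[LHS]/(`|c + w - (c - w)|) opprB addrC addrA subrK -wr.
by rewrite -mulr2n normrMn mulr_natl.
Qed.

End banakh.

(** * The one-dimensional case and the conclusion *)

Lemma full_space_singleton (R : realType) (K : choiceType) (k0 : K) :
  (forall k, k = k0) ->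
  let L := [set: ell2 R K] in
  [/\ rat_subspace L,
      forall y z, L y -> L z -> `|y| = `|z| -> y = z \/ y = - z &
      forall r : R, 0 <= r -> exists2 v, L v & `|v| = r].
Proof.
move=> Kk0 L.
have LE (y : ell2 R K) : y = y k0 *: unit_vec R k0.
  by apply: ell2_ext => k; rewrite (Kk0 k) ell2ZE unit_vecE eqxx mulr1.
have LN (y : ell2 R K) : `|y| = `|y k0|.
  by rewrite {1}[y]LE normrZ norm_unit_vec mulr1.
split=> // [y z _ _|r r0].
  rewrite !LN => /eqP; rewrite eqr_norm2 => /orP[] /eqP yz; [left|right].
    by rewrite [y]LE [z]LE yz.
  by rewrite [y]LE [z]LE yz scaleNr.
exists (r *: unit_vec R k0) => //.
by rewrite normrZ norm_unit_vec mulr1 ger0_norm.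
Qed.

Local Open Scope card_scope.

(* The cardinal kappa is represented by an index type K of that cardinality. *)
Theorem theorem15p5 (R : realType) (K : choiceType) :
  [set: K] !=set0 -> [set: K] #<= [set: R] ->
  exists L : set (ell2 R K),
    [/\ dense L, divisible L, banakh_subgroup L &
        distances L = [set r : R | 0 <= r]].
Proof.
move=> [k0 _] /pcard_leP/injfunPex[h _ hinj].
suff [L [Ld Ls Ln Lr]] : exists L : set (ell2 R K),
    [/\ dense L, rat_subspace L,
        forall y z, L y -> L z -> `|y| = `|z| -> y = z \/ y = - z &
        forall r : R, 0 <= r -> exists2 v, L v & `|v| = r].
  exists L; split=> //; first exact: rat_subspace_divisible.
    exact: norm_banakh_subgroup.
  exact: distances_norm.
have [k0_neq|Kk0] := pselect (exists k, k != k0); last first.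
  exists setT; have [] := @full_space_singleton R K k0.
    by move=> k; apply: contrapT => /eqP kk0; apply: Kk0; exists k.
  by move=> ? ? ?; split=> // O [x Ox] _; exists x.
have [T [lt [g [lt_wf lt_trans lt_total ginj small]]]] :=
  short_well_order (@real_uncountable R).
(* Index [g (0, r)] demands the norm [r], index [g (n.+1, h a)] the direction [a] up to relative
   error [1 / n.+1]. Injectivity of [g] and [h] leaves at most one demand per index. *)
pose req t : set (ell2 R K) := [set v |
  (forall r, g (0%N, r) = t -> 0 <= r -> `|v| = r) /\
  forall n a, g (n.+1, h a) = t ->
    exists2 rho, 0 < rho & `|v - rho *: unit_vec R a| < rho * n.+1%:R^-1].
have [|x [[_ xn] xreq]] :=
  @transfinite_extension R K k0 T lt req lt_wf lt_trans lt_total.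
  move=> x t xg.
  have [[r [gt r0]]|nr] := pselect (exists r, g (0%N, r) = t /\ 0 <= r).
    have [v vr vg] := good_extension_norm (small t) xg k0_neq r0.
    exists v => //; split=> [r' |n a]; rewrite -gt => /ginj[//].
    by move=> ->.
  have [[n [a gt]]|nna] := pselect (exists n a, g (n.+1, h a) = t).
    have n0 : 0 < n.+1%:R^-1 :> R by rewrite invr_gt0.
    have [v vr vg] := good_extension_direction (small t) xg k0_neq a n0.
    exists v => //; split=> [r' |m b]; rewrite -gt => /ginj[//].
    by move=> -> /hinj ->; rewrite ?inE.
  (* An index without demand receives a vector of norm 0. *)
  have [v _ vg] := good_extension_norm (small t) xg k0_neq (lexx 0).
  exists v => //; split=> [r gr r0|n a gt]; first by case: nr; exists r.
  by case: nna; exists n, a.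
have xL t : rat_span x setT (x t).
  by exists [:: (1, t)] => //; rewrite /rat_comb big_seq1 rmorph1 scale1r.
exists (rat_span x setT).
have Lsub := rat_span_subspace x setT.
split=> //.
- apply: rat_subspace_dense => // a n.
  have [_ /(_ n a erefl)[rho rho0 xrho]] := xreq (g (n.+1, h a)).
  by exists rho => //; exists (x (g (n.+1, h a))).
- move=> r r0; have [/(_ r erefl r0) xr _] := xreq (g (0%N, r)).
  by exists (x (g (0%N, r))).
Qed.
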